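(* Let $p$ be an odd prime, $n\ge 2$ an integer, and let $A$ be an integer with $p\nmid A$ of the form $$A=\frac{tp-r}{s},\quad t,r,s\in\mathbb{Z},\ s>0,\ \gcd(r,s)=1,\ |r|+s>n.$$ For $0\le j\le n-1$ let $I_j=\{x:1\le x\le p-1,\ x\equiv j\pmod n\}$. (a) If $p>|r|sn$, then $f(x)=Ax\bmod p$ (least positive residue) satisfies $f(I_i)\cap I_j\ne\emptyset$ for all $0\le i,j\le n-1$. (b) If $p>(|r|sn+1)^2$, then $f(x)=Ax^{(p+1)/2}\bmod p$ (least positive residue) satisfies $f(I_i)\cap I_j\ne\emptyset$ for all $0\le i,j\le n-1$. *)

(* Defs.v *)
From mathcomp Require Import all_boot all_order all_algebra.
From mathcomp Require Import classical_sets.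

Set Implicit Arguments.
Unset Strict Implicit.
Unset Printing Implicit Defensive.

Import Order.TTheory GRing.Theory Num.Theory.

Local Open Scope classical_set_scope.
Local Open Scope ring_scope.

Definition I_ (p n j : nat) : set int :=
  [set x : int | 1 <= x <= p%:Z - 1 /\ (x = j%:Z %[mod n%:Z])%Z].

(* [modz] is the least nonnegative residue. The maps are only applied at
   x with 1 <= x <= p - 1, and when p does not divide A the residue of A * x
   or A * x ^+ ((p + 1) / 2) is then nonzero, hence it is the least positive
   residue. *)
Definition f_lin (p : nat) (A x : int) : int := ((A * x) %% p%:Z)%Z.

Definition f_half (p : nat) (A x : int) : int :=
  ((A * x ^+ ((p + 1) %/ 2)) %% p%:Z)%Z.

(* Main.v *)
(** Put [q = |r|] and [M = q s n].  If [0 < v < p] and [x], [y] are integers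
    with [q x = v + a p] and [s y = v + b p], where [0 <= a < q] and
    [0 <= b < s], then [x] and [y] lie in [(0, p)] and [A x] is congruent to
    [-y] (if [r > 0]) or [y] (if [r < 0]) mod [p].  The difference [b - a]
    takes [q + s - 1 >= n] consecutive values, so it can be chosen such that the
    conditions [x = i] and [y = j] mod [n] become one congruence on [v] mod [M].
    Thus every pair [(i, j)] has a class [u] mod [M] all of whose
    representatives in [(0, p)] yield solutions of (a).

    For (b), [x ^ ((p + 1) / 2) = +-x] by Euler's criterion.  Were there no
    solution, the quadratic character would take opposite constant values on the
    class [u1] attached to [(i, j)] and on the class [u2] attached to
    [(i, p - j)].  As [p > M ^ 2], multiplication by [M] modulo [p] sends some
    element of [u1] into [u1] and another one into [u2], so that [M] would be
    both a square and a nonsquare. *)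
Require Import Defs.
From mathcomp Require Import all_boot all_order all_algebra.
From mathcomp Require Import boolp finfield zify ring.
From mathcomp Require Import classical_sets.

Import Order.TTheory GRing.Theory Num.Theory.

Local Open Scope classical_set_scope.
Local Open Scope ring_scope.

Lemma residue_in_window (N a u : int) : 0 < N ->
  exists v m, [/\ a <= v, v < a + N & v = u + N * m].
Proof.
move=> N_gt0; exists (a + ((u - a) %% N)%Z), (- ((u - a) %/ N)%Z).
have N_neq0 : N != 0 by lia.
have := modz_ge0 (u - a) N_neq0; have := ltz_pmod (u - a) N_gt0.
by have := divz_eq (u - a) N; split; lia.
Qed.

Lemma modz_eq (a b d : int) : 0 <= b < d -> (d %| a - b)%Z -> (a %% d)%Z = b.
Proof.
move=> b_range; rewrite -eqz_mod_dvd => /eqP ->.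
by rewrite modz_small //; lia.
Qed.

Lemma ndvdz_small (d x : int) : 0 < x < d -> ~~ (d %| x)%Z.
Proof.
move=> x_range; apply/negP => /dvdz_mod0P; rewrite modz_small; lia.
Qed.

Lemma coprimez_prime (p : nat) (N : int) : prime p -> 0 < N < p%:Z ->
  coprimez N p%:Z.
Proof.
move=> p_prime N_range; rewrite coprimezE absz_nat coprime_sym prime_coprime //.
by apply/negP => /dvdn_leq; lia.
Qed.

Lemma coprimez_inv (N p : int) : coprimez N p ->
  exists P Q, P * p = 1 + N * Q.
Proof.
case: (Bezoutz N p) => Q [P PQ] /eqP gcd1.
by exists P, (- Q); rewrite gcd1 in PQ; rewrite -PQ; ring.
Qed.

(** Eliminating [v] leaves [q i - s j + (b - a) p = n (s l - q k)]. As [p] is invertible mod [n], a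
    choice of [b - a] mod [n] makes the left side divisible by [n]; coprimality of [q] and [s] then
    gives [k] and [l]. *)
Lemma residue_class_lifts (p n q s i j : int) :
    0 < p -> 0 < n -> 0 < q -> 0 < s -> n < q + s ->
    coprimez q s -> coprimez n p ->
  exists u, forall v m, v = u + q * s * n * m -> 0 < v < p ->
    exists x y a b k l,
      [/\ 0 < x < p, 0 < y < p, q * x = v + a * p, s * y = v + b * p
        & x = i + n * k /\ y = j + n * l].
Proof.
move=> p_gt0 n_gt0 q_gt0 s_gt0 n_lt cop_qs /coprimez_inv [P [Q PQ]].
(* The window from [1 - q] to [n - q] lies in [[1 - q, s - 1]], the range of [b - a]. *)
have [kap [e [kap_ge kap_lt kapE]]] :=
  residue_in_window n (1 - q) (P * (s * j - q * i)) n_gt0.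
have [a [b [a_range b_range kap_ab]]] :
    exists a b : int, [/\ 0 <= a <= q - 1, 0 <= b <= s - 1 & kap = b - a].
  by have [kap_ge0|kap_lt0] := leP 0 kap;
    [exists 0, kap | exists (- kap), 0]; split; lia.
set K := - (Q * (s * j - q * i) + e * p).
have KE : q * i - s * j + kap * p = n * - K.
  rewrite kapE mulrDl -[P * _ * p]mulrA [_ * p]mulrC [P * (p * _)]mulrA PQ /K.
  ring.
(* The equation to solve is [q k - s l = K]; [(al K, - be K)] is one solution, and adding
   [(s m, q m)] follows [v] along its class. *)
have [al [be bezout]] := Bezoutz q s.
have {}bezout : al * q + be * s = 1 by rewrite bezout; apply/eqP.
exists (q * (i + n * (al * K)) - a * p) => v m vE v_range.
exists (i + n * (al * K + s * m)), (j + n * (- (be * K) + q * m)).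
exists a, b, (al * K + s * m), (- (be * K) + q * m).
have qxE : q * (i + n * (al * K + s * m)) = v + a * p by rewrite vE; ring.
have syE : s * (j + n * (- (be * K) + q * m)) = v + b * p.
  have -> : s * (j + n * (- (be * K) + q * m)) =
      s * j + n * (- (be * s * K)) + q * s * n * m by ring.
  have -> : be * s = 1 - al * q by rewrite -bezout; ring.
  have -> : s * j = q * i + kap * p + n * K.
    by move: KE; rewrite mulrN => KE; lia.
  by rewrite vE kap_ab; ring.
by split=> //; [move: qxE | move: syE]; nia.
Qed.

(** Put [y = M x - c p]. The class of [y] fixes [c] mod [M], so [0 <= c < M] can be had. Among the
    [M] integers just above [c p / M] one is in the class of [u]; for it [0 < y <= M ^ 2 < p]. *)
Lemma mul_between_classes (p : nat) (M u w : int) :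
    prime p -> 0 < M -> M ^+ 2 < p%:Z ->
  exists x y k l c, [/\ x = u + M * k, y = w + M * l,
    0 < x < p%:Z, 0 < y < p%:Z & M * x = y + c * p%:Z].
Proof.
move=> p_prime M_gt0 M2_lt.
have /coprimez_inv [P [Q PQ]] : coprimez M p%:Z.
  by apply: coprimez_prime => //; nia.
have [c [e [c_ge c_lt cE]]] := residue_in_window M 0 (- (P * w)) M_gt0.
have [x [k [x_ge x_lt xE]]] :=
  residue_in_window M ((c * p%:Z %/ M)%Z + 1) u M_gt0.
have M_neq0 : M != 0 by lia.
have mod_ge := modz_ge0 (c * p%:Z) M_neq0.
have mod_lt := ltz_pmod (c * p%:Z) M_gt0.
have divE := divz_eq (c * p%:Z) M.
exists x, (M * x - c * p%:Z), k, (x + Q * w - e * p%:Z), c.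
have y_gt0 : 0 < M * x - c * p%:Z by nia.
have y_lt : M * x - c * p%:Z < p%:Z by nia.
split; [by [] | | by apply/andP; split; nia | by lia | by ring].
have -> : c * p%:Z = - (P * p%:Z * w) + M * e * p%:Z by rewrite cE; ring.
by rewrite PQ; ring.
Qed.

Lemma mem_I (p n j : nat) (x k : int) :
  0 < x < p%:Z -> x = j%:Z + n%:Z * k -> I_ p n j x.
Proof.
move=> x_range xE; split; first by lia.
by rewrite xE addrC mulrC modzMDl.
Qed.

Lemma I_P (p n j : nat) (x : int) :
  I_ p n j x -> 0 < x < p%:Z /\ exists k, x = j%:Z + n%:Z * k.
Proof.
case=> x_range /eqP; rewrite eqz_mod_dvd => /dvdzP [k xE].
by split; [lia | exists k; lia].
Qed.

(** The congruence of [|r| x] and [v] mod [p] serves (b): it ties the quadratic character of [x] to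
    that of [v]. *)
Lemma f_lin_class (p n i j : nat) (A t r s : int) :
    prime p -> (0 < n)%N -> 0 < s -> r != 0 -> s * A = t * p%:Z - r ->
    coprimez r s -> n%:Z < `|r| + s -> `|r| * s * n%:Z < p%:Z ->
  exists u, forall v m, v = u + `|r| * s * n%:Z * m -> 0 < v < p%:Z ->
    exists2 x, I_ p n i x /\ I_ p n j (f_lin p A x)
             & (p%:Z %| `|r| * x - v)%Z.
Proof.
move=> p_prime n_gt0 s_gt0 r_neq0 sA cop_rs n_lt M_lt.
have q_gt0 : 0 < `|r| by rewrite normr_gt0.
have p_gt0 := prime_gt0 p_prime.
have cop_qs : coprimez `|r| s by move: cop_rs; rewrite !coprimezE -abszE absz_nat.
have qs_gt0 : 0 < `|r| * s by rewrite mulr_gt0.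
have qn_gt0 : 0 < `|r| * n%:Z by rewrite mulr_gt0.
have cop_np : coprimez n%:Z p%:Z by apply: coprimez_prime => //; nia.
have cop_ps : coprimez p%:Z s.
  rewrite coprimez_sym; apply: coprimez_prime => //.
  by move: M_lt; rewrite mulrAC; nia.
have [r_gt0|r_lt0] := ltP 0 r.
(* Here the value of the map is [p - y], so [y] is sought in the class of [p - j]. *)
- have [||||||| u uP] := @residue_class_lifts p%:Z n%:Z `|r| s i%:Z (p%:Z - j%:Z);
    do ?[by []|by lia].
  exists u => v m vE v_range.
  have [x [y [a [b [k [l [x_range y_range qx sy [xE yE]]]]]]]] := uP v m vE v_range.
  exists x; last by rewrite qx addrAC subrr add0r dvdz_mull.
  split; first exact: mem_I x_range xE.
  have -> : f_lin p A x = p%:Z - y.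
    apply: modz_eq; first by lia.
    rewrite -(Gauss_dvdzr _ cop_ps); apply/dvdzP; exists (t * x - a + b - s).
    have -> : s * (A * x - (p%:Z - y)) = s * A * x - s * p%:Z + s * y by ring.
    rewrite sA sy mulrBl.
    have -> : r * x = v + a * p%:Z by rewrite -qx gtr0_norm.
    by ring.
  by apply: (@mem_I _ _ _ _ (- l)); lia.
- have [||||||| u uP] := @residue_class_lifts p%:Z n%:Z `|r| s i%:Z j%:Z;
    do ?[by []|by lia].
  exists u => v m vE v_range.
  have [x [y [a [b [k [l [x_range y_range qx sy [xE yE]]]]]]]] := uP v m vE v_range.
  exists x; last by rewrite qx addrAC subrr add0r dvdz_mull.
  split; first exact: mem_I x_range xE.
  have -> : f_lin p A x = y.
    apply: modz_eq; first by lia.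
    rewrite -(Gauss_dvdzr _ cop_ps); apply/dvdzP; exists (t * x + a - b).
    have -> : s * (A * x - y) = s * A * x - s * y by ring.
    rewrite sA sy mulrBl.
    have -> : r * x = - (v + a * p%:Z) by rewrite -qx ler0_norm; [ring|lia].
    by ring.
  exact: mem_I y_range yE.
Qed.

Lemma Euler_criterion_dvdz (p : nat) (x : int) : prime p -> odd p ->
    0 < x < p%:Z ->
  (p%:Z %| x ^+ (p %/ 2) - 1)%Z \/ (p%:Z %| x ^+ (p %/ 2) + 1)%Z.
Proof.
move=> p_prime p_odd x_range; apply/orP.
rewrite !(dvdz_pcharf (pchar_Fp p_prime)) rmorphB rmorphD rmorphXn rmorph1 /=.
have : x%:~R != 0 :> 'F_p.
  by rewrite -(dvdz_pcharf (pchar_Fp p_prime)) ndvdz_small.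
set z := x%:~R => z_neq0.
have zp : z ^+ p = z by have := expf_card z; rewrite card_Fp.
(* Fermat, with [2 (p %/ 2) + 1 = p] because [p] is odd. *)
have zh : z * (z ^+ (p %/ 2)) ^+ 2 = z.
  by rewrite -exprM -exprS -[RHS]zp; congr (_ ^+ _); lia.
rewrite -mulf_eq0 -subr_sqr expr1n subr_eq0; apply/eqP.
by apply: (mulfI z_neq0); rewrite zh mulr1.
Qed.

Lemma f_half_square (p : nat) (A x : int) : odd p ->
  (p%:Z %| x ^+ (p %/ 2) - 1)%Z -> f_half p A x = f_lin p A x.
Proof.
move=> p_odd x_sq; apply/eqP; rewrite /f_half /f_lin eqz_mod_dvd.
have -> : ((p + 1) %/ 2 = (p %/ 2).+1)%N by lia.
rewrite exprS (_ : _ - _ = A * x * (x ^+ (p %/ 2) - 1)); last by ring.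
exact: dvdz_mull.
Qed.

Lemma f_half_nonsquare (p : nat) (A x : int) : odd p ->
    0 < f_lin p A x < p%:Z -> (p%:Z %| x ^+ (p %/ 2) + 1)%Z ->
  f_half p A x = p%:Z - f_lin p A x.
Proof.
move=> p_odd y_range x_nsq; apply: modz_eq; first by lia.
have -> : ((p + 1) %/ 2 = (p %/ 2).+1)%N by lia.
have fE : f_lin p A x = A * x - (A * x %/ p%:Z)%Z * p%:Z.
  by rewrite [X in X - _](divz_eq (A * x) p%:Z) addrAC subrr add0r.
rewrite exprS fE.
rewrite (_ : _ - _ = A * x * (x ^+ (p %/ 2) + 1)
                     - ((A * x %/ p%:Z)%Z + 1) * p%:Z); last by ring.
by rewrite rpredB // dvdz_mull.
Qed.

Theorem theorem5p1 (p n : nat) (A t r s : int)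
    (p_prime : prime p) (p_odd : odd p) (n_ge2 : (2 <= n)%N)
    (p_ndvd_A : ~~ (p%:Z %| A)%Z)
    (s_gt0 : 0 < s)
    (A_def : A%:Q = (t * p%:Z - r)%:Q / s%:Q)
    (rs_coprime : gcdz r s = 1)
    (rs_large : n%:Z < `|r| + s) :
  (`|r| * s * n%:Z < p%:Z ->
     forall i j : nat, (i <= n - 1)%N -> (j <= n - 1)%N ->
       f_lin p A @` I_ p n i `&` I_ p n j !=set0)
  /\
  ((`|r| * s * n%:Z + 1) ^+ 2 < p%:Z ->
     forall i j : nat, (i <= n - 1)%N -> (j <= n - 1)%N ->
       f_half p A @` I_ p n i `&` I_ p n j !=set0).
Proof.
have sA : s * A = t * p%:Z - r.
  apply/eqP; rewrite -(eqr_int rat) intrM A_def mulrC divfK //.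
  by rewrite intr_eq0; lia.
(* If [r = 0], coprimality forces [s = 1], so [|r| + s = 1 < n]. *)
have r_neq0 : r != 0.
  by apply/eqP => r0; move: rs_coprime rs_large; rewrite r0 gcd0z; lia.
have cop_rs : coprimez r s by apply/eqP.
have q_gt0 : 0 < `|r| by rewrite normr_gt0.
set M := `|r| * s * n%:Z.
have M_gt0 : 0 < M by rewrite /M !mulr_gt0 //; lia.
have n_gt0 : (0 < n)%N by lia.
have classP i j (M_lt : M < p%:Z) := @f_lin_class p n i j A t r s
  p_prime n_gt0 s_gt0 r_neq0 sA cop_rs rs_large M_lt.
split=> [M_lt i j _ _|M_lt i j _ _].
  have [u uP] := classP i j M_lt.
  have [v [m [v_ge v_lt vE]]] := residue_in_window M 1 u M_gt0.
  have [|x [xI fxI] _] := uP v m vE; first by lia.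
  by exists (f_lin p A x); split=> //; exists x.
have M2_lt : M ^+ 2 < p%:Z by move: M_lt; rewrite sqrrD1; lia.
have {}M_lt : M < p%:Z by nia.
(* A natural number congruent to [p - j] mod [n]: reflection [y -> p - y] sends its class to that of
   [j]. *)
set j' := (p + (n - 1) * j)%N.
have [u1 u1P] := classP i j M_lt.
have [u2 u2P] := classP i j' M_lt.
apply: contrapT => no_sol.
have congE (a b : int) : (p%:Z %| a - b)%Z = (a%:~R == b%:~R :> 'F_p).
  by rewrite (dvdz_pcharf (pchar_Fp p_prime)) rmorphB subr_eq0.
set h := (p %/ 2)%N.
pose Q : 'F_p := `|r|%:~R ^+ h.
(* If [x] were a square, both maps would agree at [x] and solve the problem. *)
have chi1 v m : v = u1 + M * m -> 0 < v < p%:Z -> v%:~R ^+ h = - Q.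
  move=> vE v_range; have [x [xI fxI] qxv] := u1P v m vE v_range.
  have [x_range _] := I_P _ _ _ _ xI.
  have [x_sq|] := Euler_criterion_dvdz _ _ p_prime p_odd x_range.
    case: no_sol; exists (f_half p A x).
    by split; [exists x | rewrite f_half_square].
  rewrite -[1]opprK congE rmorphXn rmorphN1 /= => /eqP xh.
  by move: qxv; rewrite congE => /eqP <-; rewrite rmorphM /= exprMn xh mulrN1.
(* If [x] were a nonsquare, the reflected value would lie in the class of [j]. *)
have chi2 v m : v = u2 + M * m -> 0 < v < p%:Z -> v%:~R ^+ h = Q.
  move=> vE v_range; have [x [xI fxI] qxv] := u2P v m vE v_range.
  have [x_range _] := I_P _ _ _ _ xI; have [y_range [k yE]] := I_P _ _ _ _ fxI.
  have [|x_nsq] := Euler_criterion_dvdz _ _ p_prime p_odd x_range; last first.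
    case: no_sol; exists (f_half p A x); split; first by exists x.
    rewrite f_half_nonsquare //.
    apply: (@mem_I _ _ _ _ (- k - j%:Z)); first by lia.
    by rewrite yE /j' PoszD PoszM -subzn //; ring.
  rewrite congE rmorphXn rmorph1 /= => /eqP xh.
  by move: qxv; rewrite congE => /eqP <-; rewrite rmorphM /= exprMn xh mulr1.
have mulE x y c : M * x = y + c * p%:Z ->
    y%:~R ^+ h = M%:~R ^+ h * x%:~R ^+ h :> 'F_p.
  move=> MxE; rewrite -exprMn -rmorphM /= MxE rmorphD rmorphM /=.
  by rewrite -[p%:Z%:~R]/(p%:R) pchar_Fp_0 // mulr0 addr0.
have [x [y [k [l [c [xE yE x_range y_range /mulE]]]]]] :=
  @mul_between_classes p M u1 u1 p_prime M_gt0 M2_lt.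
rewrite (chi1 _ _ xE) // (chi1 _ _ yE) // => eq1.
have [x' [y' [k' [l' [c' [xE' yE' x_range' y_range' /mulE]]]]]] :=
  @mul_between_classes p M u1 u2 p_prime M_gt0 M2_lt.
rewrite (chi1 _ _ xE') // (chi2 _ _ yE') // -eq1 => /eqP.
(* Now [Q = - Q], impossible since [p] is odd and [0 < |r| <= M < p]. *)
rewrite -addr_eq0 -mulr2n -mulr_natl mulf_eq0 expf_eq0.
have two_neq0 : 2%:R != 0 :> 'F_p.
  rewrite -(dvdn_pcharf (pchar_Fp p_prime)); apply/negP => /dvdn_leq.
  by have := prime_gt1 p_prime; lia.
rewrite (negPf two_neq0) /= => /andP [_].
rewrite -(dvdz_pcharf (pchar_Fp p_prime)); apply/negP/ndvdz_small.
have q_le : `|r| <= M by rewrite /M -mulrA ler_peMr ?ltW //; nia.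
by lia.
Qed.
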